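(* Let $(u_n)_{n=0}^{\infty}$ be a real-valued non-decreasing convex sequence, and let $(n_k)_{k=0}^{\infty}$ be a sequence of indices in $\mathbb{N}$ such that for every $k\in\mathbb{N}$ the triplet $n_{k-1},n_k,n_{k+1}$ is a convex triplet. Then the subsequence $(u_{n_k})_{k=0}^{\infty}$ is convex (as a sequence in $k$).
   Context: $\mathbb{N}$ denotes the set of positive integers. A real sequence $(x_n)_{n=0}^{\infty}$ is called convex if $2x_n\le x_{n-1}+x_{n+1}$ for all $n\in\mathbb{N}$. A triplet $n_{k-1},n_k,n_{k+1}\in\mathbb{N}\cup\{0\}$ with $n_{k-1}<n_k<n_{k+1}$ is called a convex triplet if $0\le n_k-n_{k-1}\le n_{k+1}-n_k$. *)

(* Defs.v *)
From mathcomp Require Import all_boot all_order all_algebra.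
From mathcomp Require Import reals.

Set Implicit Arguments.
Unset Strict Implicit.
Unset Printing Implicit Defensive.

Import Order.TTheory GRing.Theory Num.Theory.
Local Open Scope ring_scope.

Definition convex_seq (R : realType) (x : nat -> R) : Prop :=
  forall n : nat, (0 < n)%N -> 2 * x n <= x n.-1 + x n.+1.

(* The truncated subtractions are exact because of [a < b < c]. *)
Definition convex_triplet (a b c : nat) : Prop :=
  (a < b < c)%N /\ (0 <= b - a <= c - b)%N.

(* Main.v *)
Require Import Defs.
From mathcomp Require Import all_boot all_order all_algebra.
From mathcomp Require Import reals.
From mathcomp Require Import lra.

(** Convexity says that the one-step increments [u n.+1 - u n] are
    nondecreasing in [n]; summing [p] consecutive ones, the increment of [u]
    over a window of length [p] can only grow when the window is shifted to the
    right ([convex_seq_window]).  For a convex triplet [a < b < c] put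
    [p = b - a]: shifting the window from [a] to [b] gives
    [u b - u a <= u (b + p) - u b].  The triplet condition is
    [b + p <= c], so monotonicity of [u] replaces [u (b + p)] by [u c], which
    is the convexity inequality of the subsequence at [b]. *)

Set Implicit Arguments.
Unset Strict Implicit.
Unset Printing Implicit Defensive.

Import Order.TTheory GRing.Theory Num.Theory.
Local Open Scope ring_scope.

Lemma convex_seq_increment (R : realType) (u : nat -> R) :
  convex_seq u ->
  {homo (fun n => u n.+1 - u n) : m n / (m <= n)%N >-> m <= n}.
Proof.
move=> u_convex; apply: homo_leq => [x|y x z|n]; [exact: lexx|exact: le_trans|].
by have /= := u_convex n.+1 isT; lra.
Qed.

Lemma convex_seq_window (R : realType) (u : nat -> R) (a b p : nat) :
  convex_seq u -> (a <= b)%N -> u (a + p)%N - u a <= u (b + p)%N - u b.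
Proof.
move=> u_convex le_ab; elim: p => [|p IHp]; first by rewrite !addn0 !subrr.
have le_shift : (a + p <= b + p)%N by rewrite leq_add2r.
have /= := convex_seq_increment u_convex le_shift.
by rewrite !addnS; lra.
Qed.

Theorem proposition3p3 (R : realType) (u : nat -> R) (idx : nat -> nat)
  (u_nondecreasing : {homo u : m n / (m <= n)%N >-> m <= n})
  (u_convex : convex_seq u)
  (idx_pos : forall k : nat, (0 < idx k)%N)
  (idx_triplet : forall k : nat, (0 < k)%N ->
    convex_triplet (idx k.-1) (idx k) (idx k.+1)) :
  convex_seq (fun k : nat => u (idx k)).
Proof.
move=> k /idx_triplet [/andP[/ltnW le_ab /ltnW le_bc] /andP[_ le_gap]].
have le_end : (idx k + (idx k - idx k.-1) <= idx k.+1)%N.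
  by rewrite -(subnKC le_bc) leq_add2l.
have := convex_seq_window (idx k - idx k.-1) u_convex le_ab.
have := u_nondecreasing _ _ le_end.
by rewrite (subnKC le_ab); lra.
Qed.
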